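(* Let $T$ be an ordinary numerical semigroup with $T\neq\mathbb{N}$, and let $I$ be a set of non-negative integers with $|I|>1$. Then: (i) $\omega(S_I^I(T))=2\min(T^* )-1$; (ii) $\omega(S_J^I(T))=\infty$ for any non-empty proper subset $J$ of $I$.
   Context: $\mathbb{N}$ is the set of non-negative integers. For a non-empty set $I\subseteq\mathbb{N}$, $\mathbb{N}^{(I)}$ is the additive monoid (componentwise addition) of all sequences $(n_i)_{i\in I}$ of non-negative integers with $n_i=0$ for all but finitely many $i$; $\mathbf{0}$ is the zero sequence. An ordinary numerical semigroup is a submonoid of $\mathbb{N}$ of the form $T=\{0\}\cup(m+\mathbb{N})$ with $m$ a positive integer; $T^*=T\setminus\{0\}$. For $\emptyset\ne J\subseteq I$ (possibly $J=I$) and $\mathbf{x}=(x_i)_{i\in I}\in\mathbb{N}^{(I)}$, put $|\mathbf{x}|_J=\sum_{j\in J}x_j$, and define the submonoid $S_J^I(T)=\{\mathbf{x}\in\mathbb{N}^{(I)}:|\mathbf{x}|_J\in T\setminus\{0\}\}\cup\{\mathbf{0}\}$ of $\mathbb{N}^{(I)}$. For a submonoid $S$ of $\mathbb{N}^{(I)}$, $S^*=S\setminus\{\mathbf{0}\}$ and $\mathcal{A}(S)=S^*\setminus(S^*+S^* )$ is the set of atoms. Write $\mathbf{a}\le_S\mathbf{b}$ if $\mathbf{b}-\mathbf{a}\in S$. For $\mathbf{s}\in S$, the $\omega$-primality $\omega(\mathbf{s})$ is the least positive integer $N$ such that whenever $\mathbf{s}\le_S\mathbf{s}_1+\cdots+\mathbf{s}_n$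 with $\mathbf{s}_1,\dots,\mathbf{s}_n\in S$, there is $K\subseteq\{1,\dots,n\}$ with $|K|\le N$ and $\mathbf{s}\le_S\sum_{j\in K}\mathbf{s}_j$ ($\omega(\mathbf{s})=\infty$ if there is no such $N$). Finally $\omega(S)=\sup\{\omega(\mathbf{a}):\mathbf{a}\in\mathcal{A}(S)\}\in\mathbb{N}\cup\{\infty\}$. *)

(* Defs.v *)
From HB Require Import structures.
From mathcomp Require Import all_boot all_order all_algebra finmap.
From mathcomp Require Import boolp classical_sets functions cardinality.
From mathcomp Require Import constructive_ereal.

Set Implicit Arguments.
Unset Strict Implicit.
Unset Printing Implicit Defensive.

Import Order.TTheory GRing.Theory Num.Theory.
Local Open Scope classical_set_scope.
Local Open Scope ring_scope.

(* The minimum of A if A has one, and x0 otherwise. *)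
Definition least d (X : porderType d) (x0 : X) (A : set X) : X :=
  xget x0 (A `&` lbound A).

Section FinitelySupportedSequences.
Variable K : choiceType.

Definition fsseq := {fsfun K -> nat with 0%N}.

HB.instance Definition _ := Choice.on fsseq.

Definition fsseq0 : fsseq := [fsfun].

Definition fsseq_add (x y : fsseq) : fsseq :=
  [fsfun i in (finsupp x `|` finsupp y)%fset => (x i + y i)%N].

Lemma fsseq_addE (x y : fsseq) i : fsseq_add x y i = (x i + y i)%N.
Proof.
rewrite fsfunE; case: ifPn => //.
rewrite in_fsetU negb_or => /andP[/fsfun_dflt -> /fsfun_dflt ->] //.
Qed.

Lemma fsseq_addA : associative fsseq_add.
Proof. by move=> x y z; apply/fsfunP => i; rewrite !fsseq_addE addnA. Qed.

Lemma fsseq_addC : commutative fsseq_add.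
Proof. by move=> x y; apply/fsfunP => i; rewrite !fsseq_addE addnC. Qed.

Lemma fsseq_add0 : left_id fsseq0 fsseq_add.
Proof. by move=> x; apply/fsfunP => i; rewrite fsseq_addE fsfun0E. Qed.

HB.instance Definition _ :=
  GRing.isNmodule.Build fsseq fsseq_addA fsseq_addC fsseq_add0.

End FinitelySupportedSequences.

Section Submonoids.
Variable M : nmodType.
Implicit Types (S : set M) (s : M).

Definition atoms S : set M :=
  (S `\ 0) `\` [set a + b | a in S `\ 0 & b in S `\ 0].

(* b - a belongs to S; no subtraction is available in M. *)
Definition le_in S (a b : M) : Prop := exists2 c, S c & b = a + c.

Definition omega_bound S s (N : nat) : Prop :=
  forall (n : nat) (t : 'I_n -> M), (forall i, S (t i)) ->
    le_in S s (\sum_(i < n) t i) ->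
  exists2 K : {set 'I_n}, (#|K| <= N)%N & le_in S s (\sum_(i in K) t i).

(* Values in N u {oo} are taken in \bar int, where suprema of sets of such
   values are again such values. *)
Definition omega S s : \bar int :=
  least +oo%E [set (N%:Z)%:E | N in [set N | (0 < N)%N /\ omega_bound S s N]].

(* The default value 0 of [supremum] is only used when S has no atom. *)
Definition omega_sup S : \bar int := supremum 0%:E (omega S @` atoms S).

End Submonoids.

Definition ordinary_semigroup (T : set nat) : Prop :=
  exists2 m, (0 < m)%N & T = [set 0%N] `|` [set (m + n)%N | n in setT].

(* The index set I : set nat is used as the type of its elements, so that
   fsseq I is N^(I); J is a subset of nat, intended to be included in I. *)
Definition partial_sum (I J : set nat) (x : fsseq I) : nat :=
  (\sum_(i <- finsupp x | val i \in J) x i)%N.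

Definition SJI (I J T : set nat) : set (fsseq I) :=
  [set x | (T `\ 0%N) (partial_sum J x)] `|` [set 0].

Arguments SJI : clear implicits.

(* Main.v *)
(* The atoms of S_J^I(T), with m = min T^*, are the x with m <= |x|_J < 2m.
   When J = I, a sum lying above an atom a still lies above a, coordinate by
   coordinate, after keeping at most |a| of its terms; padding these to 2m-1
   terms makes the remainder large enough to be in the monoid.  Conversely
   (2m-1)e_i needs all the 2m-1 copies of e_i + (m-1)e_j.  When i is outside J
   and j is inside, m e_j + N e_i is an atom for every N, and it needs all the N
   copies of m e_j + e_i. *)
Require Import Defs.
From HB Require Import structures.
From mathcomp Require Import all_boot all_order all_algebra finmap.
From mathcomp Require Import boolp classical_sets functions cardinality.
From mathcomp Require Import constructive_ereal.
From mathcomp Require Import zify.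

Set Implicit Arguments.
Unset Strict Implicit.
Unset Printing Implicit Defensive.

Import Order.TTheory GRing.Theory Num.Theory.
Local Open Scope classical_set_scope.
Local Open Scope ring_scope.

(** * Identifying minima and suprema *)

Lemma least_eq d (X : porderType d) (x0 x : X) (A : set X) :
  A x -> lbound A x -> least x0 A = x.
Proof.
move=> Ax lbx; apply: xget_unique => [//|y [Ay lby]].
by apply: le_anti; rewrite lby //= lbx.
Qed.

(** Nonemptiness of [A] rules out the default [x0], and suprema are unique. *)
Lemma supremum_eq d (X : orderType d) (x0 x : X) (A : set X) :
  A !=set0 -> ubound A x -> lbound (ubound A) x -> supremum x0 A = x.
Proof.
move=> /set0P /negbTE A0 ubx lubx; rewrite /supremum A0.
by apply: xget_unique => // y ?; apply: (@is_subset1_supremums _ _ A).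
Qed.

Lemma supremum_max d (X : orderType d) (x0 x : X) (A : set X) :
  A x -> ubound A x -> supremum x0 A = x.
Proof. by move=> Ax ubx; apply: supremum_eq => [|//|y]; [exists x | apply]. Qed.

(** * Estimates for omega-primality *)

Section Omega.
Variables (M : nmodType) (S : set M) (s : M).

Variant omega_spec : \bar int -> Prop :=
| OmegaFinite N of (0 < N)%N & omega_bound S s N
    & (forall N', (0 < N')%N -> omega_bound S s N' -> (N <= N')%N) :
    omega_spec (N%:Z)%:E
| OmegaInfinite of (forall N, (0 < N)%N -> ~ omega_bound S s N) :
    omega_spec +oo%E.

(** If some bound exists, well-ordering of the naturals gives a least one; otherwise the set is
    empty and [least] returns its default value, infinity. *)
Lemma omegaP : omega_spec (omega S s).
Proof.
have [exN|nexN] := pselect (exists N, `[< (0 < N)%N /\ omega_bound S s N >]).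
  case: (ex_minnP exN) => N /asboolP[N0 bN] minN.
  have minN' N' : (0 < N')%N -> omega_bound S s N' -> (N <= N')%N.
    by move=> ? ?; apply: minN; apply/asboolP.
  suff -> : omega S s = (N%:Z)%:E by constructor.
  apply: least_eq => [|_ [N' [? ?] <-]]; first by exists N.
  by rewrite lee_fin lez_nat; apply: minN'.
have noN N : (0 < N)%N -> ~ omega_bound S s N.
  by move=> ? ?; apply: nexN; exists N; apply/asboolP.
suff -> : omega S s = +oo%E by constructor.
rewrite /omega /least; case: xgetP => // x _ [[N [N0 bN] _] _].
by have := noN _ N0 bN.
Qed.

Lemma omega_le N : (0 < N)%N -> omega_bound S s N -> (omega S s <= (N%:Z)%:E)%E.
Proof.
move=> N0 bN; case: omegaP => [N' _ _ /(_ _ N0 bN)|/(_ _ N0) //].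
by rewrite lee_fin lez_nat.
Qed.

Lemma omega_ge N : (forall N', omega_bound S s N' -> (N <= N')%N) ->
  ((N%:Z)%:E <= omega S s)%E.
Proof.
move=> geN; case: omegaP => [N' _ /geN|_]; last by rewrite leey.
by rewrite lee_fin lez_nat.
Qed.

End Omega.

(** * Coordinatewise arithmetic of finitely supported sequences *)

Section FinitelySupported.
Variable K : choiceType.
Implicit Types x y : fsseq K.

Definition fsseq_single (i : K) (n : nat) : fsseq K :=
  [fsfun _ in [fset i]%fset => n].

Lemma fsseq_singleE i n k : fsseq_single i n k = if k == i then n else 0%N.
Proof. by rewrite fsfunE inE. Qed.

Lemma fsseqD x y i : (x + y) i = (x i + y i)%N.
Proof. exact: fsseq_addE. Qed.

Lemma fsseq0E i : (0 : fsseq K) i = 0%N.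
Proof. exact: fsfun0E. Qed.

Lemma fsseq_sumE (L : Type) (r : seq L) (P : pred L) (t : L -> fsseq K) i :
  (\sum_(l <- r | P l) t l) i = (\sum_(l <- r | P l) t l i)%N.
Proof. by apply: (big_morph (fun x : fsseq K => x i)) => [x y|]; rewrite ?fsseqD ?fsseq0E. Qed.

Lemma fsseqMn x n i : (x *+ n) i = (x i * n)%N.
Proof. by elim: n => [|n IH]; rewrite ?muln0 ?fsseq0E // mulrS mulnS fsseqD IH. Qed.

Lemma fsseq_le_split x y : (forall i, (x i <= y i)%N) -> exists z, y = x + z.
Proof.
move=> lexy; exists [fsfun i in finsupp y => (y i - x i)%N].
apply/fsfunP => i; rewrite fsseqD fsfunE; case: finsuppP => [|_]; last by rewrite subnKC.
by move: (lexy i); case: finsuppP; lia.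
Qed.

End FinitelySupported.

(** * Additivity of the size [|x|_J] *)

Section PartialSum.
Variables (I J : set nat).
Implicit Types x y : fsseq I.

(** The extra terms vanish; sequences with different supports can thus be summed over one common
    finite set. *)
Lemma partial_sum_widen (A : {fset I}) x : (finsupp x `<=` A)%fset ->
  partial_sum J x = (\sum_(i <- A | val i \in J) x i)%N.
Proof.
move=> sxA; rewrite /partial_sum big_mkcond [RHS]big_mkcond /=.
apply: big_fset_incl => // i _ /fsfun_dflt ->; by case: ifP.
Qed.

Lemma partial_sumD x y : partial_sum J (x + y) = (partial_sum J x + partial_sum J y)%N.
Proof.
pose A := (finsupp (x + y)%R `|` (finsupp x `|` finsupp y))%fset.
rewrite !(@partial_sum_widen A).
- by rewrite -big_split; apply: eq_bigr => i _; rewrite fsseqD.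
- by apply/fsubsetP => i; rewrite !in_fsetU => ->; rewrite !orbT.
- by apply/fsubsetP => i; rewrite !in_fsetU => ->; rewrite !orbT.
- exact: fsubsetUl.
Qed.

Lemma partial_sum0 : partial_sum J (0 : fsseq I) = 0%N.
Proof. by rewrite /partial_sum big1 // => i _; rewrite fsseq0E. Qed.

Lemma partial_sum_sum (L : Type) (r : seq L) (P : pred L) (t : L -> fsseq I) :
  partial_sum J (\sum_(l <- r | P l) t l) =
  (\sum_(l <- r | P l) partial_sum J (t l))%N.
Proof. by apply: big_morph; [exact: partial_sumD | exact: partial_sum0]. Qed.

Lemma partial_sumMn x n : partial_sum J (x *+ n) = (partial_sum J x * n)%N.
Proof.
by elim: n => [|n IH]; rewrite ?muln0 ?partial_sum0 // mulrS mulnS partial_sumD IH.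
Qed.

Lemma partial_sum_single (i : I) n :
  partial_sum J (fsseq_single i n) = if val i \in J then n else 0%N.
Proof.
rewrite (@partial_sum_widen [fset i]%fset); last exact: finsupp_sub.
by rewrite big_mkcond big_seq_fset1 fsseq_singleE eqxx.
Qed.

End PartialSum.

(** * Splitting sequences into units and covering them by few summands *)

Lemma partial_sum_single_full (I : set nat) (i : I) n :
  partial_sum I (fsseq_single i n) = n.
Proof. by rewrite partial_sum_single ifT //; exact/mem_set/set_valP. Qed.

Lemma fsseq_eq0 (I : set nat) (x : fsseq I) : partial_sum I x = 0%N -> x = 0.
Proof.
move=> /eqP; rewrite sum_nat_seq_eq0 => /allP x0.
apply/fsfunP => i; rewrite fsseq0E; case: finsuppP => // /x0.
by rewrite mem_set ?implyTb => [/eqP|]; last exact: set_valP.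
Qed.

Lemma fsseq_split_unit (I J : set nat) (x : fsseq I) : (0 < partial_sum J x)%N ->
  exists i z, val i \in J /\ x = fsseq_single i 1 + z.
Proof.
move=> x0; have [i /andP[iJ xi]] : exists i, (val i \in J) && (0 < x i)%N.
  apply: contrapT => /forallNP nx; move: x0; rewrite /partial_sum big1 // => i iJ.
  by apply/eqP; rewrite -leqn0 leqNgt; apply/negP => xi; case: (nx i); rewrite iJ.
have [k|z ->] := @fsseq_le_split _ (fsseq_single i 1) x; last by exists i, z.
by rewrite fsseq_singleE; case: eqP => [->|].
Qed.

(** Units with index in [J] are moved from [z] to [y] one at a time. *)
Lemma fsseq_split_size (I J : set nat) (x : fsseq I) k : (k <= partial_sum J x)%N ->
  exists y z, x = y + z /\ partial_sum J y = k.
Proof.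
elim: k => [|k IH] kx; first by exists 0, x; rewrite add0r partial_sum0.
have [y [z [xE yk]]] := IH (ltnW kx).
have [|i [w [iJ zE]]] := @fsseq_split_unit _ J z.
  by move: kx; rewrite xE partial_sumD yk; lia.
exists (y + fsseq_single i 1), w; split; first by rewrite xE zE addrA.
by rewrite partial_sumD partial_sum_single iJ yk addn1.
Qed.

(* Each of the |a| units making up a is covered by one of the summands. *)
Lemma cover_by_few (I : set nat) n (t : 'I_n -> fsseq I) (a : fsseq I) :
  (forall i, (a i <= (\sum_l t l)%R i)%N) ->
  exists2 K : {set 'I_n}, (#|K| <= partial_sum I a)%N &
    forall i, (a i <= (\sum_(l in K) t l)%R i)%N.
Proof.
move: {2}(partial_sum I a) (erefl (partial_sum I a)) => k.
elim: k a => [|k IH] a ak lea.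
  exists finset.set0; first by rewrite cards0.
  by move=> i; rewrite (fsseq_eq0 ak) fsseq0E.
have [|i [b [_ ab]]] := @fsseq_split_unit _ I a; first by rewrite ak.
have bk : partial_sum I b = k.
  by move: ak; rewrite ab partial_sumD partial_sum_single_full => -[].
have aE j : a j = ((j == i) + b j)%N by rewrite ab fsseqD fsseq_singleE; case: eqP.
have [j|K cardK leb] := IH b bk.
  by apply: leq_trans (lea j); rewrite aE leq_addl.
have [ailt|aige] := leqP (a i) ((\sum_(l in K) t l)%R i).
  exists K => [|j]; first by lia.
  by have [->|ji] := eqVneq j i; rewrite // aE (negbTE ji) leb.
(* If all terms outside [K] vanished at [i], the full sum at [i] would equal the sum over [K], which
   is below [a i]. *)
have [l lK tl] : exists2 l, l \notin K & (0 < t l i)%N.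
  apply: contrapT => nl; move: (lea i); apply/negP; rewrite -ltnNge.
  apply: leq_trans aige; rewrite ltnS !fsseq_sumE [leqRHS]big_mkcond.
  apply: leq_sum => l _; case: ifPn => // lK.
  by rewrite leqNgt; apply/negP => tl; apply: nl; exists l.
exists (l |: K)%SET => [|j]; first by rewrite cardsU1 lK; lia.
rewrite big_setU1 //= fsseqD aE; apply: leq_add => //.
by case: eqP => // ->.
Qed.

(** It suffices to add to [A] a subset of [B] minus [A] of size [n - #|A|]; the number of these is a
    positive binomial coefficient. *)
Lemma set_between_card (L : finType) (A B : {set L}) n :
  (A \subset B)%SET -> (#|A| <= n <= #|B|)%N ->
  exists C : {set L}, [/\ (A \subset C)%SET, (C \subset B)%SET & #|C| = n].
Proof.
move=> AB /andP[An nB].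
have cardBA : #|(B :\: A)%SET| = (#|B| - #|A|)%N.
  by rewrite cardsD (finset.setIidPr AB).
have : (0 < #|[set D : {set L} | D \subset (B :\: A) & #|D| == (n - #|A|)%N]%SET|)%N.
  by rewrite cards_draws bin_gt0 cardBA; lia.
move=> /card_gt0P[D]; rewrite inE => /andP[DBA /eqP cardD].
move: DBA; rewrite subsetD => /andP[DB dis].
exists (A :|: D)%SET; split; rewrite ?finset.subsetUl ?finset.subUset ?AB //.
by rewrite cardsU finset.setIC (disjoint_setI0 dis) cards0 cardD; lia.
Qed.

(* u contributes at most 1 to the coordinate i, so n copies of u are needed. *)
Lemma omega_bound_ge (K : choiceType) (S : set (fsseq K)) (a u : fsseq K) i n N :
  S u -> (u i <= 1)%N -> a i = n -> le_in S a (u *+ n) ->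
  omega_bound S a N -> (n <= N)%N.
Proof.
move=> Su ui ain aun bN.
have [|A cardA [c _]] := bN n (fun=> u) (fun=> Su); first by rewrite sumr_const card_ord.
rewrite sumr_const => /(congr1 (fun x : fsseq K => x i)).
by rewrite fsseqMn fsseqD ain => E; apply: leq_trans cardA; nia.
Qed.

(** * The monoids [S_J^I(T)] for [m = min T^*] at least 2 *)

Section OrdinarySemigroup.
Variables (m : nat) (I : set nat).
Hypothesis m2 : (1 < m)%N.

Let T : set nat := [set 0%N] `|` [set (m + n)%N | n in setT].

Lemma ordinary_semigroupD0 k : (T `\ 0%N) k <-> (m <= k)%N.
Proof.
split; first by move=> [[->|[n _ <-]]] //= _; apply: leq_addr.
move=> mk; split; first by right; exists (k - m)%N => //; apply: subnKC.
by move=> /= k0; lia.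
Qed.

Lemma SJI_mem J x : SJI I J T x <-> (m <= partial_sum J x)%N \/ x = 0.
Proof.
by split=> -[/= ?|?]; [left; apply/ordinary_semigroupD0|right|left; apply/ordinary_semigroupD0|right].
Qed.

Lemma SJI_memD0 J x : (m <= partial_sum J x)%N -> (SJI I J T `\ 0) x.
Proof.
move=> mx; split; first by apply/SJI_mem; left.
by move=> /= x0; move: mx; rewrite x0 partial_sum0; lia.
Qed.

Lemma partial_sum_ge J x : (SJI I J T `\ 0) x -> (m <= partial_sum J x)%N.
Proof. by move=> [/SJI_mem[]]. Qed.

(** From an element of size at least [2m] a piece of size exactly [m] can be split off, leaving at
    least [m]; conversely, two nonzero elements of the monoid have total size at least [2m]. *)
Lemma atoms_SJI J x : atoms (SJI I J T) x <-> (m <= partial_sum J x < 2 * m)%N.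
Proof.
split=> [[Sx natom]|/andP[mx x2m]].
  rewrite partial_sum_ge //= ltnNge; apply/negP => x2m; apply: natom.
  have [|y [z [xE ym]]] := @fsseq_split_size _ J x m; first by lia.
  have zm : (m <= partial_sum J z)%N by move: x2m; rewrite xE partial_sumD ym; lia.
  by exists y; [apply: SJI_memD0; rewrite ym|exists z; first exact: SJI_memD0].
split; first exact: SJI_memD0.
move=> [y /partial_sum_ge my [z /partial_sum_ge mz E]].
by move: x2m; rewrite -E partial_sumD; lia.
Qed.

(** The coordinatewise difference has size at least [m], so it lies in the monoid. *)
Lemma le_in_SJI J (x y : fsseq I) : (forall i, x i <= y i)%N ->
  (partial_sum J x + m <= partial_sum J y)%N -> le_in (SJI I J T) x y.
Proof.
move=> /fsseq_le_split[c ->]; rewrite partial_sumD leq_add2l => mc.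
by exists c => //; apply/SJI_mem; left.
Qed.

(* Zero summands can be dropped. If more than 2m-1 nonzero summands are left,
   enlarge a cover of a by at most |a| of them to exactly 2m-1 summands: the
   remainder then has size at least (2m-1)m - (2m-1) >= m. *)
Lemma omega_bound_SJI_full a : (partial_sum I a < 2 * m)%N ->
  omega_bound (SJI I I T) a (2 * m - 1).
Proof.
move=> a2m n t St [c Sc sumE].
pose Z := [set l | t l != 0]%SET.
have sumZ : \sum_(l in Z) t l = \sum_l t l.
  rewrite big_mkcond; apply: eq_bigr => l _.
  by rewrite finset.inE; case: eqP.
have [cardZ|cardZ] := leqP #|Z| (2 * m - 1).
  by exists Z => //; rewrite sumZ; exists c.
have [i|K cardK leK] := @cover_by_few _ _ t a.
  by rewrite sumE fsseqD leq_addr.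
(* Removing zero summands from [K] does not change what it covers, and keeping [C] inside [Z] makes
   every term of [C] have size at least [m]. *)
have [||C [KC CZ cardC]] := @set_between_card _ (K :&: Z)%SET Z (2 * m - 1)%N.
- exact: finset.subsetIr.
- rewrite (ltnW cardZ) andbT; apply: (@leq_trans #|K|); last by lia.
  exact/subset_leq_card/finset.subsetIl.
exists C; first by rewrite cardC.
apply: le_in_SJI => [i|].
  apply: leq_trans (leK i) _; rewrite !fsseq_sumE big_mkcond [leqRHS]big_mkcond.
  apply: leq_sum => l _; case: ifPn => // lK.
  have [->|tl] := eqVneq (t l) 0; first by rewrite fsseq0E.
  by rewrite ifT // (fintype.subsetP KC) // !finset.inE lK.
have : (#|C| * m <= partial_sum I (\sum_(l in C) t l)%R)%N.
  rewrite partial_sum_sum -sum_nat_const; apply: leq_sum => l /(fintype.subsetP CZ).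
  by rewrite finset.inE => /eqP tl; apply: partial_sum_ge; split.
by rewrite cardC; nia.
Qed.

Lemma omega_SJI_full_ge (i j : I) : i != j ->
  atoms (SJI I I T) (fsseq_single i (2 * m - 1)) /\
  (((2 * m - 1)%N%:Z)%:E <= omega (SJI I I T) (fsseq_single i (2 * m - 1)))%E.
Proof.
move=> ij; have psE := partial_sum_single_full.
split; first by apply/atoms_SJI; rewrite psE; lia.
apply: omega_ge => N.
(* The summand has size exactly [m]; [2m-1] copies exceed the atom in size by [(2m-1)(m-1)], which
   is at least [m] since [m >= 2]. *)
apply: (@omega_bound_ge _ _ _ (fsseq_single i 1 + fsseq_single j (m - 1)) i).
- by apply/SJI_mem; left; rewrite partial_sumD !psE; lia.
- by rewrite fsseqD !fsseq_singleE eqxx (negbTE ij).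
- by rewrite fsseq_singleE eqxx.
apply: le_in_SJI => [k|]; last by rewrite partial_sumMn partial_sumD !psE; nia.
by rewrite fsseqMn fsseqD !fsseq_singleE; case: (k == i) => //; nia.
Qed.

Lemma omega_SJI_proper_ge (J : set nat) (i j : I) N :
  val j \in J -> val i \notin J -> (1 < N)%N ->
  let a := fsseq_single j m + fsseq_single i N in
  atoms (SJI I J T) a /\ ((N%:Z)%:E <= omega (SJI I J T) a)%E.
Proof.
move=> jJ iJ N1 a.
have psE n : partial_sum J (fsseq_single j m + fsseq_single i n) = m.
  by rewrite partial_sumD !partial_sum_single jJ (negbTE iJ) addn0.
have ij : (i == j) = false by apply: contraNF iJ => /eqP ->.
split; first by apply/atoms_SJI; rewrite psE; lia.
apply: omega_ge => N'.
apply: (@omega_bound_ge _ _ _ (fsseq_single j m + fsseq_single i 1) i).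
- by apply/SJI_mem; left; rewrite psE.
- by rewrite fsseqD !fsseq_singleE eqxx ij.
- by rewrite fsseqD !fsseq_singleE eqxx ij.
(* The [N] copies have [J]-size [N * m], which must reach [m + m]: this is where [1 < N] enters. *)
apply: le_in_SJI => [k|]; last by rewrite partial_sumMn !psE; nia.
by rewrite fsseqMn !fsseqD !fsseq_singleE; case: (k == i); case: (k == j); nia.
Qed.

End OrdinarySemigroup.

Theorem proposition7p9 (T I : set nat) (hT : ordinary_semigroup T)
    (hTN : T <> setT) (hI : (`I_2 #<= I)%card) :
  omega_sup (SJI I I T) = (2 * (least 0%N (T `\ 0%N))%:Z - 1)%:E /\
  (forall J : set nat, J !=set0 -> J `<` I ->
     omega_sup (SJI I J T) = +oo%E).
Proof.
have [m m0 TE] := hT.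
(* For [m = 1] the semigroup would be all of the naturals. *)
have m2 : (1 < m)%N.
  case: m m0 TE => [|[|]] // _ TE; case: hTN; rewrite TE.
  by apply/seteqP; split => // -[|n] _; [left | right; exists n].
have leastT : least 0%N (T `\ 0%N) = m.
  rewrite TE; apply: least_eq => [|k /(ordinary_semigroupD0 m2) //].
  exact/(ordinary_semigroupD0 m2).
split.
  have [i [j ij]] : exists i j : I, i != j.
    have [f] := pcard_leP hI.
    have If k : (k < 2)%N -> f k \in I by move=> k2; apply/mem_set/funS.
    exists (SigSub (If 0%N isT)), (SigSub (If 1%N isT)).
    by apply/eqP => /(congr1 val) /= /inj; rewrite !mem_setE => /(_ isT isT).
  have [atom_a ge_a] := omega_SJI_full_ge m2 ij.
  (* The subtraction in [nat] is not truncated, as [m] is positive. *)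
  have -> : (2 * (least 0%N (T `\ 0%N))%:Z - 1 = (2 * m - 1)%N%:Z)%R.
    by rewrite leastT; lia.
  have le_atom x : atoms (SJI I I T) x ->
      (omega (SJI I I T) x <= ((2 * m - 1)%N%:Z)%:E)%E.
    rewrite TE => /(atoms_SJI m2)/andP[_ x2m].
    by apply: omega_le; [lia|exact: omega_bound_SJI_full].
  rewrite -TE in atom_a ge_a.
  (* The supremum is attained, at the atom [(2m-1)e_i]. *)
  apply: supremum_max; last by move=> _ [x /le_atom ? <-].
  eexists; first exact: atom_a.
  by apply: le_anti; rewrite le_atom.
move=> J [j Jj] [JI nIJ].
have [i Ii nJi] : exists2 i, I i & ~ J i.
  by apply: contrapT => nIJ'; apply: nIJ => i Ii; apply: contrapT => ?; apply: nIJ'; exists i.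
pose i' : I := SigSub (mem_set Ii); pose j' : I := SigSub (mem_set (JI _ Jj)).
have ge_N N : (1 < N)%N ->
    exists2 a, atoms (SJI I J T) a & ((N%:Z)%:E <= omega (SJI I J T) a)%E.
  move=> N1; have [||atom_a ge_a] := @omega_SJI_proper_ge m I m2 J i' j' N _ _ N1.
  - exact: mem_set.
  - by apply/negP => /set_mem.
  by rewrite TE; eexists; [exact: atom_a|].
apply: supremum_eq => [||y uby]; last 1 first.
- suff -> : y = +oo%E by [].
  have le_y N : (1 < N)%N -> ((N%:Z)%:E <= y)%E.
    by move=> /ge_N[a atom_a /le_trans]; apply; apply: uby; exists a.
  case: y uby le_y => [r||] // _ le_y.
    (* A finite bound [r] is exceeded by [|r| + 2], where adding 2 also meets the condition [1 < N];
       the bound minus infinity is excluded afterwards. *)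
    have /le_y : (1 < `|r|%N + 2)%N by lia.
    by rewrite lee_fin; lia.
  by have := le_y 2 isT.
- by have [a atom_a _] := ge_N 2 isT; exists (omega (SJI I J T) a), a.
- by move=> y _; rewrite leey.
Qed.
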